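(* Let $k\in\mathbb{N}$ with $k\ge 2$, and let $\mu_k$ be the expected number of independent draws from an absolutely continuous probability distribution on $\mathbb{R}$ needed to get a streak of length $k$. Then $$\mu_k=\frac{k}{\displaystyle\sum_{s=1}^{k-1}e^{\omega_k^s}\left(1-\omega_k^{-s}\right)}.$$
   Context: $\omega_k=e^{2\pi i/k}$. If $X_1,X_2,\ldots$ are the independent, identically distributed draws, a streak of length $k$ is obtained at the first time $T\ge k$ with $X_{T-k+1}<X_{T-k+2}<\cdots<X_T$, and $\mu_k$ is the expected value of $T$. (The value of $\mu_k$ does not depend on which absolutely continuous distribution is used; the paper takes the uniform distribution on $[0,1]$ for simplicity.) *)

(* Defs.v *)
From HB Require Import structures.
From mathcomp Require Import all_boot all_order all_algebra.
From mathcomp Require Import finmap complex.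
From mathcomp Require Import all_classical all_reals all_analysis.

Set Implicit Arguments.
Unset Strict Implicit.
Unset Printing Implicit Defensive.

Import Order.TTheory GRing.Theory Num.Theory.
Import numFieldNormedType.Exports.

Local Open Scope classical_set_scope.
Local Open Scope ring_scope.

(* Stated over an arbitrary numFieldType so that the limit is taken for the
   topology induced by the norm; it is used below with the field R[i]. *)
Definition cexp (C : numFieldType) (z : C) : C :=
  limn (series (fun n => z ^+ n / n`!%:R)).

Definition omega (R : realType) (k : nat) : R[i] :=
  cexp (2 * (pi : R)%:C * 'i / k%:R)%C.

Definition mutually_independent (R : realType) (d : measure_display)
    (Omega : measurableType d) (P : probability Omega R)
    (X : nat -> {RV P >-> R}) : Prop :=
  forall (J : {fset nat}) (B : nat -> set R),
    (forall j, j \in J -> measurable (B j)) ->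
    P (\bigcap_(j in [set` J]) X j @^-1` B j) =
    (\prod_(j <- J) P (X j @^-1` B j))%E.

Definition same_distribution (R : realType) (d : measure_display)
    (Omega : measurableType d) (P : probability Omega R)
    (X Y : {RV P >-> R}) : Prop :=
  forall B : set R, measurable B -> distribution P X B = distribution P Y B.

(* The draws are indexed from 0: X i is the (i+1)-st draw, so that the last k
   of the first t draws are X (t - k), ..., X (t - 1). *)
Definition streak_ends_at (R : realType) (k : nat) (x : nat -> R) (t : nat) :
    Prop :=
  (k <= t)%N /\ forall i : nat, (t - k <= i)%N -> (i.+1 < t)%N -> x i < x i.+1.

(* +oo when no streak ever occurs, as ereal_inf set0 = +oo *)
Definition streak_time (R : realType) (k : nat) (x : nat -> R) : \bar R :=
  ereal_inf [set (t%:R)%:E | t in streak_ends_at k x].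

(* 'E_P[_] only applies to real-valued functions; this is the same integral
   for the extended-real-valued streak_time. *)
Definition expected_streak_time (R : realType) (d : measure_display)
    (Omega : measurableType d) (P : probability Omega R)
    (X : nat -> {RV P >-> R}) (k : nat) : \bar R :=
  (\int[P]_w streak_time k (fun i => X i w))%E.

(* Main.v *)
Require Import Defs.
From HB Require Import structures.
From mathcomp Require Import all_boot all_order all_algebra.
From mathcomp Require Import finmap complex.
From mathcomp Require Import all_classical all_reals all_analysis.
From mathcomp Require Import measurable_realfun.
From mathcomp Require Import zify ring lra.

(** Write [q_n] for the probability that no streak has ended by time [n].  The
    expected waiting time is [\sum_n q_n], and the theorem says that this sum is
    the inverse of [D = \sum_m (1 / (m k)! - 1 / (m k + 1)!)], since the sum over
    the roots of unity picks out of the exponential series the indices congruent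
    to 0 and to 1 modulo [k] and equals [k D] (sum_cexp_omega).

    The relation between [q] and [D] comes from a statement about one sequence
    of length [n > 0].  Call [j] admissible if the first [n - j] terms contain no
    streak and the last [j] terms are increasing.  The admissible [j], if there
    are any, are those with [r - k < j <= r] for some [r > 0], so there are as
    many multiples of [k] among them as integers congruent to 1
    (avoids_climb_balance).  For random draws the two conditions on [j] concern
    disjoint blocks, so [j] is admissible with probability [q_(n - j) / j!].
    Hence [\sum_j c_j q_(n - j) = 0] for [n > 0], where [c_j] is [1 / j!] or
    [- 1 / j!] according as [j] is congruent to 0 or to 1, and 0 otherwise
    (avoids_renewal).  The series [c] has nonnegative partial sums and a positive
    limit [D], which is enough to conclude that [\sum_n q_n = 1 / D]
    (renewal_series).

    The independence of blocks and the value [1 / j!] are obtained by counting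
    rather than by integration.  The distribution has no atoms, so the line can be
    cut into [N.+1] consecutive intervals of equal probability
    (equiprobable_cells).  The cells hit by the draws form a uniformly random word
    in [N.+1] letters, which has the same ascents as the draws unless two
    consecutive draws share a cell, an event of probability [O(1 / N)]
    (probability_avoids_word).  For words, independence of blocks is a product
    formula between cardinals, increasing words are counted by binomial
    coefficients, and the relation for [q] follows as [N] tends to infinity. *)

Set Implicit Arguments.
Unset Strict Implicit.
Unset Printing Implicit Defensive.

Import Order.TTheory GRing.Theory Num.Theory.
Import numFieldNormedType.Exports.
Local Open Scope classical_set_scope.
Local Open Scope ring_scope.

(** * Streaks in a fixed sequence *)

Section Ascents.
Local Open Scope nat_scope.

(** Position [i] carries a mark [b i] telling whether draw [i] is followed by a
    larger one.  A run of [j] draws has [j.-1] such positions, so runs of length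
    0 and 1 are always increasing. *)
Definition climb (b : nat -> bool) (j n : nat) : bool :=
  all b (iota (n - j) j.-1).

Definition streak_at (k : nat) (b : nat -> bool) (t : nat) : bool :=
  (k <= t) && climb b k t.

Definition avoids (k : nat) (b : nat -> bool) (n : nat) : bool :=
  all (fun t => ~~ streak_at k b t) (iota 0 n.+1).

Lemma climbP (b : nat -> bool) j n : j <= n ->
  reflect (forall i, n - j <= i -> i.+1 < n -> b i) (climb b j n).
Proof.
move=> jn; apply: (iffP allP) => [H i ni iN|H i].
  by apply: H; rewrite mem_iota; lia.
by rewrite mem_iota => /andP[? ?]; apply: H; lia.
Qed.

Lemma avoidsP k (b : nat -> bool) n :
  reflect (forall t, t <= n -> ~~ streak_at k b t) (avoids k b n).
Proof.
apply: (iffP allP) => [H t tn|H t].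
  by apply: H; rewrite mem_iota.
by rewrite mem_iota => /andP[_ ?]; apply: H; lia.
Qed.

(** Let [r] be the largest admissible length.  A shorter tail [j] stays
    admissible exactly until the part of the tail of length [r] that is given
    back contains [k] draws, i.e. is itself a streak; and no other streak can
    appear, because one that started before the tail of length [r] would make
    the tail of length [r.+1] increasing, against the maximality of [r]. *)
Lemma avoids_climb_interval k (b : nat -> bool) n : 1 < k -> 0 < n ->
  (exists2 j, j <= n & avoids k b (n - j) && climb b j n) ->
  exists2 r, 0 < r <= n & forall j, j <= n ->
    avoids k b (n - j) && climb b j n = (j <= r < j + k).
Proof.
move=> k1 n0 [j0 j0n fj0].
pose f j := (j <= n) && (avoids k b (n - j) && climb b j n).
have exf : exists j, f j by exists j0; rewrite /f j0n.
have leN : forall j, f j -> j <= n by move=> j /andP[].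
case: (ex_maxnP exf leN) => r /andP[rn /andP[/avoidsP ar /(climbP _ rn) cr]] maxr.
have fS i : i.+1 <= n -> avoids k b (n - i) -> climb b i.+1 n -> f i.+1.
  move=> iN /avoidsP av cl; rewrite /f iN cl andbT /=.
  by apply/avoidsP => t tn; apply: av; lia.
exists r.
  rewrite rn andbT lt0n; apply/eqP => r0.
  (* tails of length 0 and 1 are both increasing, so 0 cannot be maximal *)
  suff /maxr : f 1 by rewrite r0.
  by apply: fS => //; apply/avoidsP => t tn; apply: ar; lia.
move=> j jn; apply/idP/idP => [fj|/andP[jr rjk]].
  have jr : j <= r by apply: maxr; rewrite /f jn.
  rewrite jr /= ltnNge; apply/negP => kjr.
  move: fj => /andP[/avoidsP aj _].
  (* the first k draws of the tail of length r form a streak *)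
  have /negP := aj (n - r + k) ltac:(lia); apply; apply/andP; split; first lia.
  by apply/climbP; [lia|move=> i *; apply: cr; lia].
apply/andP; split; last by apply/climbP => // i *; apply: cr; lia.
apply/avoidsP => t tn; case: (leqP t (n - r)) => tr; first exact: ar.
apply/negP => /andP[kt /(climbP _ kt) ct].
have rn' : r.+1 <= n by lia.
(* a streak ending inside the tail but starting before it extends the tail *)
suff /maxr : f r.+1 by rewrite ltnn.
apply: fS => //; first exact/avoidsP.
apply/climbP => // i ni iN.
case: (leqP (n - r) i) => ri; first by apply: cr; lia.
by apply: ct; lia.
Qed.

(** Among [k] consecutive integers exactly one has residue [a].  The window
    [r - k < j <= r] may reach below 0, which does no harm as soon as [a <= r],
    since the representative of [a] is then still nonnegative. *)
Lemma sum_residue_window k r n a : a < k -> a <= r <= n ->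
  \sum_(j < n.+1 | j == a %[mod k]) (j <= r < j + k) = 1.
Proof.
move=> ak /andP[ar rn].
(* a + q * k is the largest integer of residue a not exceeding r *)
pose q := (r - a) %/ k.
have qr : a + q * k <= r by have := leq_divM (r - a) k; rewrite -/q; lia.
have qr2 : r < a + q * k + k.
  by have := ltn_ceil (r - a) (ltac:(lia) : 0 < k); rewrite -/q; lia.
have hj : a + q * k < n.+1 by lia.
rewrite (bigD1 (Ordinal hj)) /=; last by rewrite addnC modnMDl.
rewrite qr qr2 big1 // => j /andP[/eqP ja /eqP nj].
apply/eqP; rewrite eqb0; apply/negP => /andP[jr rj].
apply: nj; apply: val_inj => /=.
have jak : j %% k = a by rewrite ja modn_small.
have := divn_eq j k; rewrite jak => ej.
suff -> : q = j %/ k by lia.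
have : q * k < (j %/ k).+1 * k by lia.
have : (j %/ k) * k < q.+1 * k by lia.
rewrite !ltn_mul2r; lia.
Qed.

(** The pointwise identity behind the whole computation: the admissible tail
    lengths are either none, or a window of [k] consecutive integers that
    contains one multiple of [k] and one [j] congruent to 1. *)
Lemma avoids_climb_balance k (b : nat -> bool) n : 1 < k -> 0 < n ->
  \sum_(j < n.+1 | j == 0 %[mod k]) (avoids k b (n - j) && climb b j n) =
  \sum_(j < n.+1 | j == 1 %[mod k]) (avoids k b (n - j) && climb b j n).
Proof.
move=> k1 n0.
case: (boolP [exists j : 'I_n.+1, avoids k b (n - j) && climb b j n]).
  move=> /existsP[j0 fj0].
  have [|r /andP[r0 rn] rP] := @avoids_climb_interval k b n k1 n0.
    by exists j0 => //; rewrite -ltnS.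
  under eq_bigr do rewrite rP -1?ltnS //.
  under [RHS]eq_bigr do rewrite rP -1?ltnS //.
  by rewrite !sum_residue_window //; lia.
move=> /existsPn nf.
by rewrite !big1 // => j _; rewrite (negbTE (nf j)).
Qed.

End Ascents.

(** * Counting words without streaks *)

Section Words.
Local Open Scope nat_scope.

Definition word_ascent (s : seq nat) (i : nat) : bool := nth 0 s i < nth 0 s i.+1.

Lemma sum_cat_tuple (T : finType) m n (F : seq T -> nat) :
  \sum_(t : (m + n).-tuple T) F t =
  \sum_(u : m.-tuple T) \sum_(v : n.-tuple T) F (u ++ v).
Proof.
rewrite pair_bigA /=.
pose h (p : m.-tuple T * n.-tuple T) : (m + n).-tuple T := cat_tuple p.1 p.2.
have hinj : injective h.
  move=> [u v] [u' v'] /(congr1 val) /= /eqP.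
  by rewrite eqseq_cat ?size_tuple // => /andP[/eqP/val_inj -> /eqP/val_inj ->].
have hbij : bijective h.
  by apply: inj_card_bij => //; rewrite card_prod !card_tuple expnD.
by rewrite (reindex h) //=; apply: onW_bij.
Qed.

Lemma climb_cat u v : climb (word_ascent (u ++ v)) (size v) (size u + size v) =
  sorted ltn v.
Proof.
apply/climbP/(sortedP 0) => [|H i iv|H i]; first by lia.
  have := H (size u + i) ltac:(lia) ltac:(lia).
  rewrite /word_ascent !nth_cat -addnS !ifF; try lia.
  by rewrite !addKn.
rewrite addnK => ui ?.
rewrite /word_ascent !nth_cat !ifF; try lia.
rewrite subSn //.
by apply: H; lia.
Qed.

Lemma eq_avoids k b b' n : 0 < k -> (forall i, i.+1 < n -> b i = b' i) ->
  avoids k b n = avoids k b' n.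
Proof.
move=> k0 bb'; apply: eq_in_all => t; rewrite mem_iota add0n ltnS /= => tn.
congr negb; rewrite /streak_at; case: leqP => //= kt.
by apply: eq_in_all => i; rewrite mem_iota => ?; apply: bb'; lia.
Qed.

Lemma avoids_cat k u v : 0 < k ->
  avoids k (word_ascent (u ++ v)) (size u) = avoids k (word_ascent u) (size u).
Proof.
move=> k0; apply: eq_avoids => // i ?.
by rewrite /word_ascent !nth_cat !ifT //; lia.
Qed.

Definition avoiding_words (k N n : nat) : nat :=
  \sum_(t : n.-tuple 'I_N) avoids k (word_ascent (map val t)) n.

(** Avoidance constrains only the first [m] letters and the climb only the last
    [j]: the comparison of letters [m.-1] and [m] is left free.  This is what
    makes the count a product. *)
Lemma sum_avoids_climb k N m j : 0 < k ->
  \sum_(t : (m + j).-tuple 'I_N)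
    (avoids k (word_ascent (map val t)) m && climb (word_ascent (map val t)) j (m + j)) =
  avoiding_words k N m * 'C(N, j).
Proof.
move=> k0.
rewrite (sum_cat_tuple _ _ (fun s => nat_of_bool (avoids k (word_ascent (map val s)) m &&
  climb (word_ascent (map val s)) j (m + j)))).
rewrite /avoiding_words big_distrl /=; apply: eq_bigr => u _.
rewrite -card_ltn_sorted_tuples -sum1dep_card [in RHS]big_mkcond [RHS]big_distrr /=.
apply: eq_bigr => v _; rewrite map_cat.
have := avoids_cat [seq val i | i <- u] [seq val i | i <- v] k0.
have := climb_cat [seq val i | i <- u] [seq val i | i <- v].
rewrite !size_map !size_tuple => -> ->.
by case: avoids; case: sorted.
Qed.

(** Summing the pointwise identity over all words turns it into a convolution
    identity between numbers of words. *)
Lemma avoiding_words_balance k N n : 1 < k -> 0 < n ->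
  \sum_(j < n.+1 | j == 0 %[mod k]) avoiding_words k N (n - j) * 'C(N, j) =
  \sum_(j < n.+1 | j == 1 %[mod k]) avoiding_words k N (n - j) * 'C(N, j).
Proof.
move=> k1 n0.
have E (j : 'I_n.+1) : avoiding_words k N (n - j) * 'C(N, j) =
    \sum_(t : n.-tuple 'I_N) (avoids k (word_ascent (map val t)) (n - j) &&
       climb (word_ascent (map val t)) j n).
  have jn : j <= n by rewrite -ltnS.
  have := @sum_avoids_climb k N (n - j) j ltac:(lia).
  by rewrite subnK // => ->.
under eq_bigr do rewrite E.
under [RHS]eq_bigr do rewrite E.
rewrite exchange_big [RHS]exchange_big /=; apply: eq_bigr => t _.
exact: avoids_climb_balance.
Qed.

End Words.

(** * Cutting a diffuse distribution into equiprobable cells *)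

(** The quantile is the supremum of the points where the distribution function
    is at most [u]: right continuity bounds its value there from below,
    continuity of the measure from below bounds the probability of staying
    strictly under it, and the absence of atoms closes the gap. *)
Lemma cdf_quantile (R : realType) (d : measure_display)
    (Omega : measurableType d) (P : probability Omega R) (Y : {RV P >-> R})
    (u : R) :
  (forall t, distribution P Y [set t] = 0%E) -> 0 < u < 1 ->
  exists t, cdf Y t = u%:E.
Proof.
move=> diffuse /andP[u0 u1].
pose S := [set x | (cdf Y x <= u%:E)%E].
have [a Sa] : S !=set0.
  apply/set0P/negP => /eqP S0.
  have : (u%:E <= 0)%E.
    apply: (cvge_ge _ (cvg_cdfNy0 Y)); apply: nearW => x.
    by rewrite leNgt; apply/negP => /ltW xu; have : S x by []; rewrite S0.
  by rewrite lee_fin leNgt u0.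
have [b Sb] : exists b, (u%:E < cdf Y b)%E.
  apply: contrapT => /forallNP nb.
  have : (1 <= u%:E)%E.
    apply: (cvge_le _ (cvg_cdfy1 Y)); apply: nearW => x.
    by rewrite leNgt; apply/negP.
  by rewrite lee_fin leNgt u1.
have ubS : has_ubound S.
  exists b => x Sx; rewrite leNgt; apply/negP => /ltW bx.
  by have := lt_le_trans Sb (le_trans (cdf_nondecreasing Y bx) Sx); rewrite ltxx.
exists (sup S).
apply/eqP; rewrite eq_le; apply/andP; split; last first.
  apply: (cvge_ge _ (@cdf_right_continuous _ _ _ _ Y (sup S))).
  near=> x; rewrite leNgt; apply/negP => /ltW xS.
  have : x <= sup S by apply: ub_le_sup.
  by rewrite leNgt => /negP; apply; near: x; exact: nbhs_right_gt.
have -> : cdf Y (sup S) = distribution P Y `]-oo, sup S[.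
  rewrite /cdf -(@setUitv1 _ _ _ _ true) // measureU //=; first by rewrite diffuse adde0.
  by rewrite -subset0 => x /= [+ xS]; rewrite in_itv /= xS ltxx.
have -> : `]-oo, sup S[%classic = \bigcup_n `]-oo, sup S - n.+1%:R^-1]%classic.
  apply/seteqP; split=> x /=; last first.
    move=> [n _ /=]; rewrite !in_itv /= => /le_lt_trans; apply.
    by rewrite ltrBlDr ltrDl invr_gt0 ltr0n.
  rewrite in_itv /= -subr_gt0 => xS.
  have [n _ /(_ n (leqnn n)) nS] := near_infty_natSinv_lt (PosNum xS).
  by exists n => //=; rewrite in_itv /= lerBrDr addrC -lerBrDr ltW.
apply: (cvge_le _ (nondecreasing_cvg_mu _ _ _)) => //.
- near=> n; rewrite /=.
  have [s Ss sS] : exists2 s, S s & sup S - n.+1%:R^-1 < s.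
    by apply: sup_adherent; [rewrite invr_gt0 ltr0n|split; [exists a|]].
  exact: le_trans (cdf_nondecreasing Y (ltW sS)) Ss.
- exact: bigcup_measurable.
- move=> n m nm; apply/subsetPset/subset_itvl; rewrite bnd_simp.
  by rewrite lerD2l lerN2 lef_pV2 ?posrE ?ltr0n // ler_nat ltnS.
Unshelve. all: by end_near.
Qed.

Lemma count_lt_iota (R : realType) (t : nat -> R) (x : R) (N a : nat) :
  (forall i j, (0 < i <= j)%N -> (j <= N)%N -> (t i <= t j)%R) -> (0 < a <= N)%N ->
  (count (fun i => t i < x)%R (iota 1 N) < a)%N = (x <= t a).
Proof.
move=> tmono /andP[a0 aN]; apply/idP/idP => [|xt].
  apply: contraTT; rewrite -ltNge -leqNgt => tx.
  rewrite -(subnKC aN) iotaD count_cat; apply: leq_trans (leq_addr _ _).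
  have /eqP -> : count (fun i => t i < x)%R (iota 1 a) == size (iota 1 a).
    rewrite -all_count; apply/allP => i; rewrite mem_iota => ia.
    by apply: le_lt_trans tx; apply: tmono; lia.
  by rewrite size_iota.
have -> : N = (a.-1 + (N - a.-1))%N by lia.
rewrite iotaD count_cat -[X in (_ + X)%N]size_filter.
have -> : [seq i <- iota (1 + a.-1) (N - a.-1) | t i < x] = [::].
  apply/eqP; rewrite -[_ == _]negbK -has_filter; apply/hasPn => i.
  rewrite mem_iota -leNgt => ia; apply: le_trans xt _.
  by apply: tmono; lia.
rewrite addn0; apply: leq_ltn_trans (count_size _ _) _.
by rewrite size_iota; lia.
Qed.

(** Cutting the line at the quantiles [i / N.+1] gives consecutive intervals of
    equal probability; the cell of [x] is the number of cuts lying below [x]. *)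
Lemma equiprobable_cells (R : realType) (d : measure_display)
    (Omega : measurableType d) (P : probability Omega R) (Y : {RV P >-> R})
    (N : nat) :
  (forall t, distribution P Y [set t] = 0%E) ->
  exists cell : R -> 'I_N.+1,
    [/\ forall x y, x <= y -> (cell x <= cell y)%N,
        forall a, measurable (cell @^-1` [set a]) &
        forall a, distribution P Y (cell @^-1` [set a]) = (N.+1%:R^-1)%:E].
Proof.
move=> diffuse.
have N0 : 0 < N.+1%:R :> R by rewrite ltr0n.
have /choice[t ht] : forall i, exists t, (0 < i <= N)%N ->
    cdf Y t = (i%:R / N.+1%:R)%:E.
  move=> i; case: (boolP (0 < i <= N)%N) => [/andP[i0 iN]|_]; last by exists 0.
  have [|s hs] := @cdf_quantile R d Omega P Y (i%:R / N.+1%:R) diffuse.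
    by rewrite divr_gt0 ?ltr0n //= ltr_pdivrMr // mul1r ltr_nat ltnS.
  by exists s.
have tmono i j : (0 < i <= j)%N -> (j <= N)%N -> t i <= t j.
  move=> /andP[i0]; rewrite leq_eqVlt => /orP[/eqP -> //|ij jN].
  rewrite leNgt; apply/negP => /ltW /(cdf_nondecreasing Y).
  rewrite !ht; [|lia..].
  by rewrite lee_fin ler_pM2r ?invr_gt0 // ler_nat leqNgt ij.
pose c x := count (fun i => t i < x) (iota 1 N).
have cN x : (c x < N.+1)%N.
  by rewrite ltnS (leq_trans (count_size _ _)) // size_iota.
(* the union of the first a cells: a half-line, except at both ends *)
pose L a := [set x | (c x < a)%N].
have LE a : (0 < a <= N)%N -> L a = `]-oo, t a]%classic.
  by move=> aN; apply/seteqP; split=> x /=; rewrite in_itv /= /L /= count_lt_iota.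
have mL a : measurable (L a).
  have [aN|] := boolP (0 < a <= N)%N; first by rewrite LE.
  rewrite negb_and -!ltnNge ltnS leqn0 => /orP[/eqP ->|Na].
    by rewrite (_ : L 0 = set0) // -subset0.
  by rewrite (_ : L a = setT) // -subTset => x _; apply: leq_trans (cN x) Na.
have PL a : (a <= N.+1)%N -> distribution P Y (L a) = (a%:R / N.+1%:R)%:E.
  move=> aN1; have [aN|] := boolP (0 < a <= N)%N; first by rewrite LE // -ht.
  rewrite negb_and -!ltnNge ltnS leqn0 => /orP[/eqP ->|Na].
    by rewrite (_ : L 0 = set0) ?measure0 ?mul0r // -subset0.
  have -> : a = N.+1 by lia.
  rewrite (_ : L _ = setT) ?probability_setT ?divff ?gt_eqF //.
  by rewrite -subTset => x _; exact: cN.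
have cellE (a : 'I_N.+1) :
    (fun x => Ordinal (cN x)) @^-1` [set a] = L a.+1 `\` L a.
  apply/seteqP; split=> x /=; rewrite /L /=.
    by move=> <- /=; split; rewrite ?ltnn.
  by move=> [xa /negP ax]; apply: val_inj => /=; lia.
have LS a : L a `<=` L a.+1 by move=> x /=; exact: leqW.
exists (fun x => Ordinal (cN x)); split=> [x y xy|a|a].
- by rewrite /= /c; apply: sub_count => i /= /lt_le_trans; apply.
- by rewrite cellE; apply: measurableD.
- rewrite cellE measureD //=; last first.
    by apply: le_lt_trans (probability_le1 _ _) _ => //; rewrite ltry.
  rewrite setIidr // (PL _ (ltn_ord a)) (PL _ (ltnW (ltn_ord a))).
  by rewrite -EFinB -mulrBl -[a.+1]addn1 natrD addrC addKr mul1r.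
Qed.

(** * From draws to words *)

Lemma measure_finType_pred (R : realType) (d : measure_display)
    (Omega : measurableType d) (P : {measure set Omega -> \bar R})
    (T : finType) (C : Omega -> T) (phi : pred T) :
  (forall u, measurable (C @^-1` [set u])) ->
  measurable [set w | phi (C w)] /\
  P [set w | phi (C w)] = (\sum_(u | phi u) P (C @^-1` [set u]))%E.
Proof.
move=> mC; rewrite -big_enum.
have -> : [set w | phi (C w)] = [set w | C w \in enum phi].
  by apply/seteqP; split=> w /=; rewrite mem_enum.
elim: (enum phi) (enum_uniq phi) => [_|u s IH /= /andP[us /IH[mS PS]]].
  by rewrite big_nil (_ : [set w | _] = set0) ?measure0 // -subset0.
have -> : [set w | C w \in u :: s] = C @^-1` [set u] `|` [set w | C w \in s].
  apply/seteqP; split=> w /=; rewrite inE.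
    by move=> /orP[/eqP|]; [left|right].
  by move=> [->|->]; rewrite ?eqxx ?orbT.
split; first exact: measurableU.
rewrite measureU //= ?big_cons ?PS //.
by rewrite -subset0 => w /= [-> us']; rewrite us' in us.
Qed.

Lemma measurable_all (d : measure_display) (Omega : measurableType d)
    (I : Type) (s : seq I) (p : I -> Omega -> bool) :
  (forall i, measurable [set w | p i w]) ->
  measurable [set w | all (fun i => p i w) s].
Proof.
move=> mp; elim: s => [|i s IH] /=.
  by rewrite (_ : [set w | _] = setT) // -subTset.
have -> : [set w | p i w && all (p^~ w) s] =
    [set w | p i w] `&` [set w | all (p^~ w) s].
  by apply/seteqP; split=> w /= /andP.
exact: measurableI.
Qed.

Definition draw_ascent (R : realType) (Omega : Type) (X : nat -> Omega -> R) (w : Omega)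
  (i : nat) : bool := X i w < X i.+1 w.

Lemma measurable_avoids (R : realType) (d : measure_display)
    (Omega : measurableType d) (X : nat -> Omega -> R) (k n : nat) :
  (forall i, measurable_fun setT (X i)) ->
  measurable [set w | avoids k (draw_ascent X w) n].
Proof.
move=> mX.
apply: (@measurable_all _ _ _ _ (fun t w => ~~ streak_at k (draw_ascent X w) t)) => t.
have -> : [set w | ~~ streak_at k (draw_ascent X w) t] =
    ~` [set w | streak_at k (draw_ascent X w) t].
  by apply/seteqP; split=> w /= /negP.
apply: measurableC; rewrite /streak_at; case: leqP => kt /=; last first.
  by rewrite (_ : [set w | _] = set0) // -subset0.
apply: (@measurable_all _ _ _ _ (fun i w => X i w < X i.+1 w)) => i.
have := measurable_fun_ltr (mX i) (mX i.+1).
by move=> /(_ measurableT [set true]); rewrite setTI; exact.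
Qed.

Section Discretisation.
Context (R : realType) (d : measure_display) (Omega : measurableType d).
Variables (P : probability Omega R) (X : nat -> {RV P >-> R}) (N : nat).
Variable cell : R -> 'I_N.+1.
Hypothesis indep : mutually_independent X.
Hypothesis ident : forall n, same_distribution (X n) (X 0%N).
Hypothesis cell_mono : forall x y, x <= y -> (cell x <= cell y)%N.
Hypothesis mcell : forall a, measurable (cell @^-1` [set a]).
Hypothesis Pcell :
  forall a, distribution P (X 0%N) (cell @^-1` [set a]) = (N.+1%:R^-1)%:E.

Lemma probability_cells (J : {fset nat}) (u : nat -> 'I_N.+1) :
  P (\bigcap_(j in [set` J]) X j @^-1` (cell @^-1` [set u j])) =
  (N.+1%:R ^- #|` J|)%:E.
Proof.
rewrite (indep (B := fun j => cell @^-1` [set u j])) //.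
rewrite (eq_bigr (fun=> (N.+1%:R^-1)%:E)); last first.
  by move=> j _; rewrite -(Pcell (u j)) -(ident j).
by rewrite prodEFin big_const_seq count_predT iter_mulr_1 exprVn.
Qed.

Definition word (n : nat) (w : Omega) : n.-tuple 'I_N.+1 :=
  [tuple cell (X i w) | i < n].

Lemma nth_word n w j : (j < n)%N -> nth ord0 (word n w) j = cell (X j w).
Proof.
move=> jn.
exact: (@nth_mktuple n _ (fun i : 'I_n => cell (X i w)) ord0 (Ordinal jn)).
Qed.

Lemma measurable_cell i a : measurable [set w | cell (X i w) = a].
Proof. exact: (measurable_funPTI (X i) (mcell a)). Qed.

Lemma word_fiber n (u : n.-tuple 'I_N.+1) :
  word n @^-1` [set u] = \bigcap_(j in [set` [fset i in iota 0 n]%fset])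
     X j @^-1` (cell @^-1` [set nth ord0 u j]).
Proof.
apply/seteqP; split=> w /=.
  move=> <- j /=; rewrite in_fset /= mem_iota /= add0n => jn.
  exact/esym/nth_word.
move=> H; apply: eq_from_tnth => i; rewrite tnth_mktuple (tnth_nth ord0).
by apply: (H (val i)); rewrite /= in_fset /= mem_iota /= add0n.
Qed.

Lemma measurable_word n u : measurable (word n @^-1` [set u]).
Proof.
rewrite word_fiber; apply: fin_bigcap_measurable => //= i _.
exact: measurable_cell.
Qed.

Lemma probability_word n u : P (word n @^-1` [set u]) = (N.+1%:R ^- n)%:E.
Proof.
rewrite word_fiber (@probability_cells _ (fun j => nth ord0 u j)).
by rewrite card_imfset //= undup_id ?iota_uniq // size_iota.
Qed.

(** Independence makes all words equally likely, so probabilities of events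
    about the word of cells are proportions of words. *)
Lemma probability_word_pred n (phi : pred (n.-tuple 'I_N.+1)) :
  P [set w | phi (word n w)] = ((\sum_t phi t)%N%:R / N.+1%:R ^+ n)%:E.
Proof.
have [_ ->] := measure_finType_pred P phi (@measurable_word n).
rewrite (eq_bigr (fun=> (N.+1%:R ^- n)%:E)); last first.
  by move=> u _; exact: probability_word.
by rewrite sumEFin sumr_const -big_mkcond sum1_card mulr_natl.
Qed.

Lemma probability_tie i :
  P [set w | cell (X i w) == cell (X i.+1 w)] = (N.+1%:R^-1)%:E.
Proof.
pose C w := (cell (X i w), cell (X i.+1 w)).
have CE a b : C @^-1` [set (a, b)] = \bigcap_(j in [set` [fset i; i.+1]%fset])
    X j @^-1` (cell @^-1` [set if j == i then a else b]).
  apply/seteqP; split=> w /=.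
    move=> [<- <-] j /=; rewrite !inE => /orP[/eqP ->|/eqP ->]; rewrite ?eqxx //.
    by rewrite gtn_eqF.
  move=> H; rewrite /C; have := H i; rewrite /= !inE eqxx /= => -> //.
  by have := H i.+1; rewrite /= !inE eqxx orbT gtn_eqF //= => ->.
have mC u : measurable (C @^-1` [set u]).
  case: u => a b; rewrite CE; apply: fin_bigcap_measurable => //= j _.
  exact: measurable_cell.
have [_] := measure_finType_pred P (fun u => u.1 == u.2) mC.
rewrite /= => ->.
rewrite (eq_bigr (fun=> (N.+1%:R ^- 2)%:E)); last first.
  move=> [a b] _; rewrite CE (@probability_cells _ (fun j => if j == i then a else b)).
  by rewrite cardfs2 neq_ltn ltnSn.
rewrite sumEFin sumr_const.
have -> : #|[pred u : 'I_N.+1 * 'I_N.+1 | u.1 == u.2]| = N.+1.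
  rewrite -[RHS]card_ord -(card_imset predT (f := fun a => (a, a))).
    apply: eq_card => -[a b]; rewrite !inE /=; apply/eqP/imsetP => [->|[c _ [-> ->]]] //.
    by exists b.
  by move=> a b [].
congr EFin; rewrite -[LHS]mulr_natl expr2 invfM mulrA divff ?mul1r //.
Qed.

Definition ties (n : nat) : set Omega :=
  \big[setU/set0]_(i < n) [set w | cell (X i w) == cell (X i.+1 w)].

Lemma measurable_tie i : measurable [set w | cell (X i w) == cell (X i.+1 w)].
Proof.
have := @measure_finType_pred _ _ _ P _ (fun w => (cell (X i w), cell (X i.+1 w)))
  (fun u => u.1 == u.2).
case=> // -[a b].
rewrite (_ : _ @^-1` _ =
  [set w | cell (X i w) = a] `&` [set w | cell (X i.+1 w) = b]).
  by apply: measurableI; exact: measurable_cell.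
by apply/seteqP; split=> w /= [-> ->].
Qed.

Lemma measurable_ties n : measurable (ties n).
Proof. by apply: bigsetU_measurable => i _; exact: measurable_tie. Qed.

Lemma probability_ties n : (P (ties n) <= (n%:R / N.+1%:R)%:E)%E.
Proof.
apply: (le_trans (@Boole_inequality _ _ _ P
  (fun i => [set w | cell (X i w) == cell (X i.+1 w)]) n _)).
  by move=> i _; exact: measurable_tie.
rewrite (eq_bigr (fun=> (N.+1%:R^-1)%:E)) => [|i _]; last exact: probability_tie.
by rewrite sumEFin sumr_const card_ord mulr_natl.
Qed.

(** Cells are ordered like the draws, so comparing two draws and comparing their
    cells can only disagree when both fall in the same cell. *)
Lemma avoids_word k n w : (0 < k)%N -> ~ ties n w ->
  avoids k (draw_ascent X w) n = avoids k (word_ascent (map val (word n w))) n.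
Proof.
move=> k0 nt; apply: eq_avoids => // i ni.
have ne : cell (X i w) != cell (X i.+1 w).
  apply/negP => e; apply: nt; rewrite /ties.
  rewrite -(bigcup_mkord n (fun i => [set w | cell (X i w) == cell (X i.+1 w)])).
  by exists i => //=; exact: ltnW.
have nthE j : (j < n)%N -> nth 0%N (map val (word n w)) j = cell (X j w).
  by move=> jn; rewrite (nth_map ord0) ?size_tuple // nth_word.
rewrite /draw_ascent /word_ascent (nthE _ ni) (nthE _ (ltnW ni)).
apply/idP/idP => [/ltW/cell_mono|].
  by rewrite leq_eqVlt => /orP[/eqP/val_inj/eqP|//]; rewrite (negbTE ne).
by rewrite ltnNge ltNge; apply: contra => /cell_mono.
Qed.

(** The discretised event differs from the original one only when two
    consecutive draws share a cell, and each such tie has probability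
    [1 / N.+1]. *)
Lemma probability_avoids_word k n : (0 < k)%N ->
  `|fine (P [set w | avoids k (draw_ascent X w) n]) -
    (avoiding_words k N.+1 n)%:R / N.+1%:R ^+ n| <= n%:R / N.+1%:R.
Proof.
move=> k0.
set A := [set w | _].
pose B := [set w | avoids k (word_ascent (map val (word n w))) n].
have mA : measurable A by apply: measurable_avoids => i; exact: measurable_funP.
have mB : measurable B.
  have := @measure_finType_pred _ _ _ P _ (word n)
    (fun t => avoids k (word_ascent (map val t)) n) (@measurable_word n).
  by case.
have PB : P B = ((avoiding_words k N.+1 n)%:R / N.+1%:R ^+ n)%:E.
  exact: (probability_word_pred (fun t => avoids k (word_ascent (map val t)) n)).
have le (U V : set Omega) : measurable U -> measurable V -> U `<=` V `|` ties n ->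
    fine (P U) <= fine (P V) + n%:R / N.+1%:R.
  move=> mU mV UV; rewrite -lee_fin EFinD !fineK ?fin_num_measure //.
  apply: (@le_trans _ _ (P (V `|` ties n))).
    by apply: le_measure; rewrite ?inE //; apply: measurableU => //; exact: measurable_ties.
  apply: (le_trans (measureU2 P mV (measurable_ties n))).
  by apply: leeD => //; exact: probability_ties.
have AB : A `<=` B `|` ties n.
  move=> w; rewrite /A /= => Aw; have [tw|tw] := pselect (ties n w); first by right.
  by left; rewrite /B /= -avoids_word.
have BA : B `<=` A `|` ties n.
  move=> w; rewrite /B /= => Bw; have [tw|tw] := pselect (ties n w); first by right.
  by left; rewrite /A /= avoids_word.
have := le _ _ mA mB AB; have := le _ _ mB mA BA; rewrite PB /=.
move: (fine (P A)) (_ / N.+1%:R ^+ n) (n%:R / N.+1%:R) => a b c ? ?.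
by rewrite ler_norml; apply/andP; split; lra.
Qed.
End Discretisation.

(** * The renewal equation *)

(** The proportion of increasing words of length [j] tends to [1 / j!]: this is
    the probability that [j] draws come in increasing order. *)
Lemma cvg_binomial_ratio (R : realType) (j : nat) :
  'C(N.+1, j)%:R / N.+1%:R ^+ j @[N --> \oo] --> (j`!%:R^-1 : R).
Proof.
elim: j => [|j IH].
  under eq_cvg do rewrite bin0 expr0 divr1.
  by rewrite fact0 invr1; exact: cvg_cst.
have jS : (j.+1%:R : R) != 0 by rewrite pnatr_eq0.
have E : (j.+1`!%:R^-1 : R) = j`!%:R^-1 * ((1 - j%:R * 0) / j.+1%:R).
  by rewrite mulr0 subr0 mul1r factS natrM invfM mulrC.
rewrite E.
apply: (@cvg_trans _ ('C(N.+1, j)%:R / N.+1%:R ^+ j *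
    ((1 - j%:R * (N.+1%:R)^-1) / j.+1%:R) @[N --> \oo])); last first.
  apply: cvgM => //; apply: cvgM (cvg_cst _); apply: cvgB; first exact: cvg_cst.
  by apply: cvgM; [exact: cvg_cst|exact: cvg_harmonic].
apply: near_eq_cvg; near=> N.
have jN : (j <= N.+1)%N by rewrite ltnW // ltnS; near: N; exact: nbhs_infty_ge.
have NS : (N.+1%:R : R) != 0 by rewrite pnatr_eq0.
have /(congr1 (fun n => n%:R : R)) := mul_bin_left N.+1 j.
rewrite !natrM natrB // => B.
have -> : 'C(N.+1, j.+1)%:R = (N.+1%:R - j%:R) * 'C(N.+1, j)%:R / j.+1%:R :> R.
  by rewrite -B mulrAC divff // mul1r.
rewrite exprS; move: jS NS (expf_neq0 j NS).
move: ('C(N.+1, j)%:R) (N.+1%:R ^+ j) => b p; move: (j.+1%:R) (N.+1%:R) => x y.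
move=> x0 y0 p0; field; rewrite p0 y0.
Unshelve. all: by end_near.
Qed.

(** The coefficients of
    [\sum_m (x ^ (m k) / (m k)! - x ^ (m k + 1) / (m k + 1)!)], the reciprocal of
    the generating function of the probabilities of seeing no streak. *)
Definition renewal_coef (R : realType) (k j : nat) : R :=
  ((j == 0 %[mod k])%:R - (j == 1 %[mod k])%:R) / j`!%:R.

(** Formally the two generating functions are inverse to each other and one
    evaluates at 1.  Summing the convolution identities up to [M] gives
    [\sum_(n <= M) q n * C (M - n) = 1] with [C] the partial sums of [c]; as
    these are nonnegative and eventually close to [D], the sum is squeezed
    between [(D - e)] and [(D + e)] times a partial sum of [q], up to a piece of
    fixed length that vanishes. *)
Lemma renewal_series (R : realType) (q c : nat -> R) (D : R) :
  (forall n, 0 <= q n) ->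
  (forall n, \sum_(j < n.+1) c j * q (n - j)%N = (n == 0%N)%:R) ->
  (forall n, 0 <= series c n) ->
  series c @ \oo --> D -> 0 < D ->
  series q @ \oo --> D^-1.
Proof.
move=> q0 qc c0 cD D0.
have conv M : \sum_(n < M.+1) q n * series c (M - n).+1 = 1.
  elim: M => [|M IH].
    rewrite big_ord_recl big_ord0 addr0 /= seriesEnat /= big_nat1.
    by have := qc 0%N; rewrite big_ord_recl big_ord0 addr0 mulrC.
  rewrite big_ord_recr /= subnn.
  transitivity (\sum_(n < M.+1) q n * series c (M - n).+1 +
     (\sum_(n < M.+1) q n * c (M.+1 - n)%N + q M.+1 * c 0%N)).
    rewrite addrA -big_split /=; congr (_ + _); last first.
      by rewrite seriesEnat /= big_nat1.
    apply: eq_bigr => n _; rewrite -mulrDr; congr (_ * _).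
    by rewrite subSn -1?ltnS // !seriesEnat /= [LHS]big_nat_recr.
  rewrite IH; have := qc M.+1; rewrite (reindex_inj rev_ord_inj) /=.
  rewrite big_ord_recr /= subSS subnn subn0 => qcM.
  rewrite [X in _ + X](_ : _ = 0) ?addr0 // -[RHS]qcM.
  congr (_ + _); last by rewrite mulrC.
  apply: eq_bigr => n _; rewrite mulrC; congr (c _ * q _); have := ltn_ord n; lia.
have qnd : nondecreasing_seq (series q).
  by apply/nondecreasing_series => n _ _; exact: q0.
have sq0 n : 0 <= series q n by apply: sumr_ge0 => i _; exact: q0.
have near_D e : 0 < e -> exists L, forall l, (L <= l)%N ->
    D - e <= series c l <= D + e.
  move=> e0; move/cvgrPdist_le : cD => /(_ e e0) [L _ HL].
  by exists L => l /HL /=; rewrite distrC ler_norml => /andP[? ?]; apply/andP; split; lra.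
have sqE n : series q n = \sum_(i < n) q i by rewrite seriesEord.
(* stop the sums L terms early, so that all partial sums of c involved are
   within e of D *)
have upper e : 0 < e -> forall m, series q m * (D - e) <= 1.
  move=> e0 m; have [L HL] := near_D e e0.
  rewrite -(conv (m + L)%N) -addnS big_split_ord /= sqE mulr_suml.
  rewrite -[leLHS]addr0 lerD //; last first.
    by apply: sumr_ge0 => i _; apply: mulr_ge0.
  apply: ler_sum => i _; apply: ler_wpM2l => //.
  by have /andP[] := HL (m + L - i).+1 ltac:(have := ltn_ord i; lia).
have cvq : cvgn (series q).
  apply: nondecreasing_is_cvgn => //; exists (1 / (D / 2)) => _ [m _ <-].
  rewrite ler_pdivlMr ?divr_gt0 //.
  by have := upper (D / 2) ltac:(lra) m; rewrite (_ : D - D / 2 = D / 2) //; lra.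
set Q := limn (series q).
have cQ : series q @ \oo --> Q by exact: cvq.
have Q0 : 0 <= Q by apply: limr_ge => //; apply: nearW.
have upQ : Q * D <= 1.
  apply/ler_addgt0Pr => e e0.
  have d0 : 0 < e / (Q + 1) by apply: divr_gt0; lra.
  have : Q * (D - e / (Q + 1)) <= 1.
    apply: (@cvgr_to_le nat \oo _ R (fun m => series q m * (D - e / (Q + 1)))).
      by apply: cvgM; [exact: cQ|exact: cvg_cst].
    by apply: nearW => m; exact: upper.
  have : Q * (e / (Q + 1)) <= e.
    by rewrite mulrA ler_pdivrMr; nra.
  by rewrite mulrBr; lra.
have loQ : 1 <= Q * D.
  apply/ler_addgt0Pr => e e0.
  have d0 : 0 < e / (Q + 1) by apply: divr_gt0; lra.
  have [L HL] := near_D _ d0.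
  have [K K0 HK] : exists2 K, 0 <= K & forall n, series c n <= K.
    have /cvg_seq_bounded [K [_ /(_ (`|K| + 1))]] := cvgP _ cD.
    rewrite (le_lt_trans (ler_norm K)) ?ltrDl // => /(_ isT) HK.
    exists (`|K| + 1) => // n; exact: le_trans (ler_norm _) (HK n I).
  (* the last L.+1 terms are bounded with K; their total tends to Q - Q *)
  have : 1 <= Q * (D + e / (Q + 1)) + K * (Q - Q).
    apply: (@cvgr_to_ge nat \oo _ R (fun m => series q m * (D + e / (Q + 1)) +
        K * (series q (m + L.+1)%N - series q m))).
      apply: cvgD; first by apply: cvgM; [exact: cQ|exact: cvg_cst].
      apply: cvgM; first exact: cvg_cst.
      apply: cvgB => //.
      by rewrite (cvg_shiftn L.+1).
    apply: nearW => m.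
    rewrite -{1}(conv (m + L)%N) -addnS big_split_ord /=.
    rewrite lerD //.
      rewrite sqE mulr_suml; apply: ler_sum => i _.
      apply: ler_wpM2l => //.
      by have /andP[] := HL (m + L - i).+1 ltac:(have := ltn_ord i; lia).
    rewrite !sqE big_split_ord /= [X in K * X]addrAC subrr add0r mulr_sumr.
    by apply: ler_sum => i _; rewrite mulrC ler_wpM2r.
  have : Q * (e / (Q + 1)) <= e.
    by rewrite mulrA ler_pdivrMr; nra.
  by rewrite subrr mulr0 addr0 mulrDr; lra.
suff -> : D^-1 = Q by [].
have QD : Q * D = 1 by apply/eqP; rewrite eq_le upQ loQ.
by apply: (mulIf (lt0r_neq0 D0)); rewrite QD mulVf // lt0r_neq0.
Qed.

Lemma invr_fact_le (R : realType) (j : nat) : j.+1`!%:R^-1 <= j`!%:R^-1 :> R.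
Proof.
rewrite lef_pV2 ?posrE ?ltr0n ?fact_gt0 // ler_nat.
by rewrite factS leq_pmull.
Qed.

(** Every subtracted term [1 / (m k + 1)!] is smaller than the term [1 / (m k)!]
    added just before it, so a lower bound that keeps this last term in reserve
    propagates. *)
Lemma renewal_partial_sum_ge (R : realType) (k : nat) (delta : R) (m n : nat) :
  (1 < k)%N -> (m <= n)%N ->
  delta + (m == 0 %[mod k])%:R / m`!%:R <= series (renewal_coef R k) m.+1 ->
  delta + (n == 0 %[mod k])%:R / n`!%:R <= series (renewal_coef R k) n.+1.
Proof.
move=> k1 mn Hm; elim: n mn => [|n IH].
  by move: Hm; rewrite leqn0 => + /eqP m0; rewrite m0.
rewrite leq_eqVlt => /orP[/eqP <- //|/IH {}IH].
rewrite seriesEnat /= big_nat_recr //= -[X in _ <= X + _]/(series _ n.+1).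
have f0 i : 0 <= (i`!%:R : R)^-1 by rewrite invr_ge0.
move: IH; rewrite /renewal_coef mulrBl.
have e1 : (n.+1 == 1 %[mod k]) = (n == 0 %[mod k]) 
    by rewrite -(eqn_modDr 1 n 0) addn1 add0n.
rewrite e1; have [n0|n0] := boolP (n == 0 %[mod k]).
  have -> : (n.+1 == 0 %[mod k]) = false.
    apply/negbTE/negP; rewrite mod0n -addn1 -modnDml (eqP n0) mod0n add0n.
    by rewrite modn_small.
  by rewrite !mul0r !mul1r => h; have := invr_fact_le R n; lra.
by rewrite !mul0r => h; lra.
Qed.

Lemma renewal_partial_sum_fact (R : realType) (k n : nat) : (1 < k)%N ->
  (n == 0 %[mod k])%:R / n`!%:R <= series (renewal_coef R k) n.+1.
Proof.
move=> k1; rewrite -[leLHS]add0r; apply: (@renewal_partial_sum_ge R k 0 0 n) => //.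
rewrite add0r seriesEnat /= big_nat1 /renewal_coef eqxx.
by rewrite mod0n modn_small // subr0.
Qed.

Lemma renewal_partial_sum_ge0 (R : realType) (k n : nat) : (1 < k)%N ->
  0 <= series (renewal_coef R k) n.
Proof.
move=> k1; case: n => [|n]; first by rewrite seriesEnat /= big_nil.
by apply: le_trans (renewal_partial_sum_fact R n k1); rewrite divr_ge0.
Qed.

(** By the previous bounds, the partial sums never drop below
    [1 / k! - 1 / (k + 1)!] once the terms up to [k.+1] are included. *)
Lemma renewal_limit_gt0 (R : realType) (k : nat) (D : R) : (1 < k)%N ->
  series (renewal_coef R k) @ \oo --> D -> 0 < D.
Proof.
move=> k1 cD; pose delta : R := k`!%:R^-1 - k.+1`!%:R^-1.
have d0 : 0 < delta.
  rewrite subr_gt0 ltf_pV2 ?posrE ?ltr0n ?fact_gt0 // ltr_nat factS.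
  by rewrite ltn_Pmull ?fact_gt0 // ltnS ltnW.
apply: lt_le_trans d0 _; apply: (cvgr_to_ge cD).
exists k.+2 => // -[//|n] /= kn.
apply: le_trans (@renewal_partial_sum_ge R k delta k.+1 n k1 _ _) => //.
  by rewrite lerDl divr_ge0.
have kk : (k.+1 == 0 %[mod k]) = false.
  by apply/negbTE; rewrite -addn1 modnDl mod0n modn_small.
rewrite kk mul0r addr0 seriesEnat /= big_nat_recr //= -[X in _ <= X + _]/(series _ k.+1).
have := renewal_partial_sum_fact R k k1; rewrite modnn mod0n eqxx mul1r => h.
have -> : renewal_coef R k k.+1 = - k.+1`!%:R^-1.
  by rewrite /renewal_coef kk -{1}addn1 modnDl eqxx sub0r mulN1r.
by rewrite /delta; lra.
Qed.

Lemma is_cvg_renewal (R : realType) (k : nat) : cvgn (series (renewal_coef R k)).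
Proof.
apply: normed_cvg; apply: series_le_cvg (is_cvg_series_exp_coeff (1 : R)) => n.
- by rewrite /=.
- by rewrite /exp_coeff /= divr_ge0 // expr1n.
rewrite /exp_coeff /= expr1n /renewal_coef normrM ler_pM ?invr_ge0 //; last first.
  by rewrite ger0_norm ?invr_ge0.
by case: eqP; case: eqP => _ _; rewrite ?subr0 ?subrr ?sub0r ?normrN ?normr0 ?normr1.
Qed.

(** * The expected waiting time *)

Lemma dominated_diffuse (R : realType) (d : measure_display)
    (Omega : measurableType d) (P : probability Omega R) (Y : {RV P >-> R}) :
  distribution P Y `<< @lebesgue_measure R ->
  forall t, distribution P Y [set t] = 0%E.
Proof.
move=> dom t; apply/(measure0_null_setP _ (measurable_set1 t)); apply: dom.
by apply/measure0_null_setP; [exact: measurable_set1|exact: lebesgue_measure_set1].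
Qed.

Lemma streak_atP (R : realType) (k : nat) (x : nat -> R) (t : nat) :
  reflect (streak_ends_at k x t) (streak_at k (fun i => x i < x i.+1) t).
Proof.
rewrite /streak_at /streak_ends_at; apply: (iffP andP) => -[kt].
  by move/(climbP _ kt).
by move=> H; split=> //; apply/(climbP _ kt).
Qed.

(** The waiting time is the number of [n] such that no streak has ended by time
    [n]; if no streak ever ends, both sides are infinite. *)
Lemma streak_time_series (R : realType) (k : nat) (x : nat -> R) :
  streak_time k x =
  (\sum_(0 <= n <oo) (avoids k (fun i => x i < x i.+1) n)%:R%:E)%E.
Proof.
set b := fun i => x i < x i.+1.
have f0 n : (0 <= ((avoids k b n)%:R%:E : \bar R))%E by rewrite lee_fin.
have [[t st]|nos] := pselect (exists t, streak_at k b t); last first.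
  have av n : avoids k b n by apply/avoidsP => t _; apply/negP => ?; apply: nos; exists t.
  rewrite /streak_time (_ : [set _ | _ in _] = set0); last first.
    by rewrite -subset0 => y [t /streak_atP st ty]; apply: nos; exists t.
  rewrite ereal_inf0; apply/esym/eq_infty => r.
  apply: (@le_trans _ _ (Num.bound `|r|)%:R%:E).
    by rewrite lee_fin; apply: le_trans (ler_norm r) (ltW (archi_boundP (normr_ge0 r))).
  apply: le_trans (nneseries_lim_ge (Num.bound `|r|) _) => //.
  by under eq_bigr do rewrite av; rewrite sumEFin big_mkord sumr_const card_ord.
(* t0 is the first time at which a streak ends *)
pose t0 := ex_minn (ex_intro (fun t => streak_at k b t) t st).
have [st0 mint0] : streak_at k b t0 /\ forall t, streak_at k b t -> (t0 <= t)%N.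
  by rewrite /t0; case: ex_minnP.
have avE n : avoids k b n = (n < t0)%N.
  apply/avoidsP/idP => [H|nt0 s sn].
    by rewrite ltnNge; apply/negP => /H; rewrite st0.
  by apply/negP => /mint0; lia.
transitivity (t0%:R%:E : \bar R).
  apply/eqP; rewrite eq_le; apply/andP; split.
    by apply: ereal_inf_lbound; exists t0 => //; exact/streak_atP.
  by apply: le_ereal_inf_tmp => _ [s /streak_atP/mint0 t0s <-]; rewrite lee_fin ler_nat.
rewrite (@nneseries_split _ _ 0%N t0) // add0n.
rewrite eseries0 => [|n nt0 _]; last by rewrite avE ltnNge nt0.
rewrite adde0 sumEFin big_mkord (eq_bigr (fun=> 1)) => [|i _]; last by rewrite avE ltn_ord.
by rewrite sumr_const card_ord.
Qed.

Lemma cvg_avoiding_words (R : realType) (d : measure_display)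
    (Omega : measurableType d) (P : probability Omega R)
    (X : nat -> {RV P >-> R}) (k n : nat) :
  (0 < k)%N -> mutually_independent X ->
  (forall n, same_distribution (X n) (X 0%N)) ->
  (forall t, distribution P (X 0%N) [set t] = 0%E) ->
  (avoiding_words k N.+1 n)%:R / N.+1%:R ^+ n @[N --> \oo] -->
  fine (P [set w | avoids k (draw_ascent X w) n]).
Proof.
move=> k0 indep ident diffuse.
have n0 : n%:R * N.+1%:R^-1 @[N --> \oo] --> (0 : R).
  by rewrite -(mulr0 n%:R); apply: cvgM; [exact: cvg_cst|exact: cvg_harmonic].
apply/cvgrPdist_le => e e0.
move/cvgrPdist_le : n0 => /(_ e e0); apply: filterS => N.
rewrite sub0r normrN ger0_norm ?divr_ge0 //; apply: le_trans.
have [cell [mono mcell Pcell]] := equiprobable_cells N diffuse.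
exact: (probability_avoids_word indep ident mono mcell Pcell).
Qed.

(** The balance between numbers of words, divided by [N.+1 ^ n], in the limit of
    infinitely fine cells. *)
Lemma avoids_renewal (R : realType) (d : measure_display)
    (Omega : measurableType d) (P : probability Omega R)
    (X : nat -> {RV P >-> R}) (k n : nat) :
  (1 < k)%N -> mutually_independent X ->
  (forall n, same_distribution (X n) (X 0%N)) ->
  (forall t, distribution P (X 0%N) [set t] = 0%E) ->
  \sum_(j < n.+1) renewal_coef R k j *
    fine (P [set w | avoids k (draw_ascent X w) (n - j)%N]) = (n == 0%N)%:R.
Proof.
move=> k1 indep ident diffuse.
have k0 : (0 < k)%N by exact: ltnW.
case: n => [|n].
  rewrite big_ord_recl big_ord0 addr0 subn0 /renewal_coef mod0n modn_small //.
  rewrite eqxx subr0 fact0 divr1 mul1r (_ : [set w | _] = setT) ?probability_setT //.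
  rewrite -subTset => w _; apply/avoidsP => t; rewrite leqn0 => /eqP ->.
  by rewrite /streak_at leqNgt k0.
pose e j : R := (j == 0 %[mod k])%:R - (j == 1 %[mod k])%:R.
pose W N m : R := (avoiding_words k N.+1 m)%:R / N.+1%:R ^+ m.
pose B N j : R := 'C(N.+1, j)%:R / N.+1%:R ^+ j.
have bal N : \sum_(j < n.+2) e j * (W N (n.+1 - j)%N * B N j) = 0.
  have NS : (N.+1%:R : R) != 0 by rewrite pnatr_eq0.
  have WB (j : 'I_n.+2) : W N (n.+1 - j)%N * B N j =
      (avoiding_words k N.+1 (n.+1 - j) * 'C(N.+1, j))%N%:R / N.+1%:R ^+ n.+1.
    rewrite /W /B mulrACA -invfM -exprD subnK ?natrM //.
    by have := ltn_ord j; rewrite ltnS.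
  under eq_bigr do rewrite WB /e mulrBl mulrA mulrA -mulrBl.
  rewrite -mulr_suml sumrB.
  have S a : \sum_(j < n.+2) (j == a %[mod k])%:R *
      (avoiding_words k N.+1 (n.+1 - j) * 'C(N.+1, j))%N%:R =
      (\sum_(j < n.+2 | j == a %[mod k])
        avoiding_words k N.+1 (n.+1 - j) * 'C(N.+1, j))%N%:R :> R.
    rewrite natr_sum [RHS]big_mkcond /=; apply: eq_bigr => j _.
    by case: eqP => _; rewrite ?mul1r ?mul0r.
  by rewrite !S avoiding_words_balance // subrr mul0r.
pose L := \sum_(j < n.+2) e j *
  (fine (P [set w | avoids k (draw_ascent X w) (n.+1 - j)%N]) * j`!%:R^-1).
have cL : \sum_(j < n.+2) e j * (W N (n.+1 - j)%N * B N j) @[N --> \oo] --> L.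
  apply: cvg_big => [|j _]; first exact: add_continuous.
  apply: cvgM; first exact: cvg_cst.
  by apply: cvgM; [exact: cvg_avoiding_words|exact: cvg_binomial_ratio].
have c0 : \sum_(j < n.+2) e j * (W N (n.+1 - j)%N * B N j) @[N --> \oo] --> (0 : R).
  by under eq_cvg do rewrite bal; exact: cvg_cst.
have L0 : L = 0 by rewrite -(cvg_lim _ cL) // (cvg_lim _ c0).
rewrite /= -[RHS]L0; apply: eq_bigr => j _.
by rewrite /renewal_coef -/(e j) mulrAC mulrA.
Qed.

Lemma expected_streak_time_series (R : realType) (d : measure_display)
    (Omega : measurableType d) (P : probability Omega R)
    (X : nat -> {RV P >-> R}) (k : nat) :
  expected_streak_time X k =
  (\sum_(0 <= n <oo) P [set w | avoids k (draw_ascent X w) n])%E.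
Proof.
have mA n : measurable [set w | avoids k (draw_ascent X w) n].
  by apply: measurable_avoids => i; exact: measurable_funP.
have E w : streak_time k (fun i => X i w) =
    (\sum_(0 <= n <oo) (\1_[set w | avoids k (draw_ascent X w) n] w)%:E)%E.
  by rewrite streak_time_series; apply: eq_eseriesr => n _; rewrite indicE mem_setE.
rewrite /expected_streak_time; under eq_integral do rewrite E.
rewrite integral_nneseries //.
  apply: eq_eseriesr => n _; rewrite integral_indic // setIT //.
by move=> n; apply/measurable_EFinP; exact: measurable_indic.
Qed.

(** The expected waiting time is the sum of the tail probabilities, and the
    renewal identity evaluates that sum. *)
Lemma expected_streak_time_renewal (R : realType) (d : measure_display)
    (Omega : measurableType d) (P : probability Omega R)
    (X : nat -> {RV P >-> R}) (k : nat) :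
  (1 < k)%N -> mutually_independent X ->
  (forall n, same_distribution (X n) (X 0%N)) ->
  (forall t, distribution P (X 0%N) [set t] = 0%E) ->
  expected_streak_time X k = ((limn (series (renewal_coef R k)))^-1)%:E.
Proof.
move=> k1 indep ident diffuse; rewrite expected_streak_time_series.
pose q n := fine (P [set w | avoids k (draw_ascent X w) n]).
have mA n : measurable [set w | avoids k (draw_ascent X w) n].
  by apply: measurable_avoids => i; exact: measurable_funP.
have Pq n : P [set w | avoids k (draw_ascent X w) n] = (q n)%:E.
  by rewrite fineK // fin_num_measure.
under eq_eseriesr do rewrite Pq.
have cD := @is_cvg_renewal R k.
have D0 := renewal_limit_gt0 k1 cD.
apply/cvg_lim => //.
have -> : (fun n => \sum_(0 <= i < n) (q i)%:E)%E = EFin \o series q.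
  by apply/funext => n; rewrite sumEFin.
apply: cvg_EFin; first exact: nearW.
apply: renewal_series cD D0 => n; last exact: renewal_partial_sum_ge0.
  by rewrite fine_ge0.
exact: avoids_renewal.
Qed.

(** * The sum over the roots of unity *)

(** The topology on which [cexp] relies is the one carried by every normed
    field; the cast makes it visible on complex numbers. *)
Notation complex_field R := (R[i] : numFieldType).

Lemma normC_le_ReIm (R : realType) (z : R[i]) :
  `|z| <= ((`|complex.Re z| + `|complex.Im z|)%:C)%C.
Proof.
rewrite normc_def lecR -[leRHS]ger0_norm ?addr_ge0 // -sqrtr_sqr.
apply: ler_wsqrtr; rewrite sqrrD !real_normK ?num_real //.
by rewrite lerD2r lerDl mulrn_wge0 // mulr_ge0.
Qed.

Lemma cvg_complex (R : realType) (u : nat -> complex_field R)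
    (a : complex_field R) :
  (fun n => complex.Re (u n)) @ \oo --> complex.Re a ->
  (fun n => complex.Im (u n)) @ \oo --> complex.Im a ->
  u @ \oo --> a.
Proof.
move=> cRe cIm; apply/cvgrPdist_le => e e0.
have [e' e'0 ee'] : exists2 e' : R, 0 < e' & e = (e'%:C)%C.
  case: e e0 => x y; rewrite ltcE /= => /andP[/eqP -> x0].
  by exists x.
move/cvgrPdist_le : cRe => /(_ (e' / 2) ltac:(lra)).
move/cvgrPdist_le : cIm => /(_ (e' / 2) ltac:(lra)).
apply: filterS2 => n; rewrite ee' => hb ha.
apply: le_trans (normC_le_ReIm _) _; rewrite lecR.
rewrite (_ : complex.Re _ = complex.Re a - complex.Re (u n)); last first.
  by case: (a) => ? ?; case: (u n).
rewrite (_ : complex.Im _ = complex.Im a - complex.Im (u n)); last first.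
  by case: (a) => ? ?; case: (u n).
by move: hb ha; lra.
Qed.

Lemma Re_sum (R : realType) (u : nat -> R[i]) (n : nat) :
  complex.Re (\sum_(0 <= i < n) u i) = \sum_(0 <= i < n) complex.Re (u i).
Proof.
by apply: (big_ind2 (fun z r => complex.Re z = r)) => // -[a b] c [a' b'] c' <- <-.
Qed.

Lemma Im_sum (R : realType) (u : nat -> R[i]) (n : nat) :
  complex.Im (\sum_(0 <= i < n) u i) = \sum_(0 <= i < n) complex.Im (u i).
Proof.
by apply: (big_ind2 (fun z r => complex.Im z = r)) => // -[a b] c [a' b'] c' <- <-.
Qed.

Lemma cvg_complex_series (R : realType) (u : nat -> complex_field R)
    (a : complex_field R) :
  series (fun n => complex.Re (u n)) @ \oo --> complex.Re a ->
  series (fun n => complex.Im (u n)) @ \oo --> complex.Im a ->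
  series u @ \oo --> a.
Proof.
move=> cRe cIm; apply: cvg_complex.
- by under eq_cvg do rewrite seriesEnat Re_sum.
- by under eq_cvg do rewrite seriesEnat Im_sum.
Qed.

Lemma is_cvg_cexp (R : realType) (z : complex_field R) :
  series (fun n => z ^+ n / n`!%:R) @ \oo --> cexp z.
Proof.
pose t n : R[i] := z ^+ n / n`!%:R.
have [r r0 zr] : exists2 r : R, 0 <= r & `|z| = (r%:C)%C.
  by exists (Num.sqrt (complex.Re z ^+ 2 + complex.Im z ^+ 2)); rewrite ?sqrtr_ge0 ?normc_def.
have tr n : `|t n| = ((exp_coeff r n)%:C)%C.
  rewrite /t /exp_coeff /= normrM normrX zr normfV normr_nat.
  by rewrite rmorphM rmorphXn fmorphV rmorph_nat.
have Re_le n : `|complex.Re (t n)| <= exp_coeff r n.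
  by rewrite -lecR -tr; exact: normc_ge_Re.
have Im_le n : `|complex.Im (t n)| <= exp_coeff r n.
  rewrite -[complex.Im _]opprK -ReiNIm normrN -lecR -tr.
  apply: le_trans (normc_ge_Re _) _; rewrite normrM.
  by rewrite (normc_def 'i%C) /= expr0n add0r expr1n sqrtr1 mulr1.
have cv (f : nat -> R) : (forall n, `|f n| <= exp_coeff r n) -> cvgn (series f).
  move=> fr; apply: normed_cvg; apply: series_le_cvg (is_cvg_series_exp_coeff r) => n.
  - exact: normr_ge0.
  - exact: exp_coeff_ge0.
  - exact: fr.
have cRe := cv _ Re_le; have cIm := cv _ Im_le.
apply: cvgP; apply: (@cvg_complex_series _ t
  (Complex (limn (series (fun n => complex.Re (t n))))
           (limn (series (fun n => complex.Im (t n)))))).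
- exact: cRe.
- exact: cIm.
Qed.

(** The powers are written with the coefficients of the cosine and sine series,
    for the comparison of the exponential with these series. *)
Lemma imaginary_pow (R : realType) (x : R) (n : nat) :
  (Complex 0 x : R[i]) ^+ n =
  Complex ((~~ odd n)%:R * (-1) ^+ n./2 * x ^+ n)
          ((odd n)%:R * (-1) ^+ n.-1./2 * x ^+ n).
Proof.
elim: n => [|n IH]; first by rewrite !expr0 !mul1r !mul0r.
rewrite exprSr IH /=; apply/eqP; rewrite eq_complex /=.
rewrite !mulr0 sub0r addr0 !exprSr uphalf_half -!mulrA.
have [on|on] := boolP (odd n); last by rewrite !mul0r oppr0 !eqxx.
have -> : n.-1./2 = n./2 by case: n on {IH} => //= n; rewrite uphalf_half => /negbTE ->.
by rewrite !mul1r !mul0r exprS mulN1r mulNr !eqxx.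
Qed.

Lemma cexp_imaginary (R : realType) (x : R) :
  cexp (Complex 0 x : complex_field R) = Complex (cos x) (sin x).
Proof.
apply/(cvg_lim (@norm_hausdorff _ _)) => //.
have E n : (Complex 0 x : R[i]) ^+ n / n`!%:R = Complex (cos_coeff x n) (sin_coeff x n).
  rewrite imaginary_pow -(rmorph_nat (real_complex R)) -fmorphV /=.
  by apply/eqP; rewrite eq_complex /= !mulr0 subr0 add0r !eqxx.
apply: cvg_complex_series.
  under eq_fun do rewrite E /=.
  by rewrite /= cos.unlock; exact: is_cvg_series_cos_coeff.
under eq_fun do rewrite E /=.
by rewrite /= sin.unlock; exact: is_cvg_series_sin_coeff.
Qed.

Lemma omegaE (R : realType) (k : nat) :
  omega R k = Complex (cos (2 * pi / k%:R)) (sin (2 * pi / k%:R)).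
Proof.
rewrite -cexp_imaginary /omega; congr cexp.
rewrite -!(rmorph_nat (real_complex R)) -fmorphV /=.
apply/eqP; rewrite eq_complex /=; apply/andP; split; apply/eqP; ring.
Qed.

Lemma omega_pow (R : realType) (k m : nat) :
  omega R k ^+ m =
  Complex (cos (m%:R * (2 * pi / k%:R))) (sin (m%:R * (2 * pi / k%:R))).
Proof.
elim: m => [|m IH]; first by rewrite mul0r cos0 sin0.
rewrite exprSr IH omegaE; move: (2 * pi / k%:R) => th.
rewrite -[m.+1%:R]natr1 mulrDl mul1r cosD sinD.
by apply/eqP; rewrite eq_complex /= eqxx addrC eqxx.
Qed.

(** [cos (2 y) = 1 - 2 (sin y) ^ 2] with [0 < y < pi] shows that no earlier power
    is 1. *)
Lemma omega_primitive (R : realType) (k : nat) : (0 < k)%N ->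
  k.-primitive_root (omega R k).
Proof.
move=> k0; have kR : (0 : R) < k%:R by rewrite ltr0n.
apply/andP; split=> //; apply/forallP => i; apply/eqP; rewrite unity_rootE omega_pow.
have [->|ik] := eqVneq i.+1 k.
  have -> : k%:R * (2 * pi / k%:R) = pi *+ 2 :> R.
    by rewrite -[RHS]mulr_natl mulrC divfK // gt_eqF.
  rewrite cos2pi sin2pi.
  by rewrite eq_complex /= !eqxx.
apply/negbTE; rewrite eq_complex negb_and /=; apply/orP; left.
have ik' : (i.+1 < k)%N by rewrite ltn_neqAle ik ltn_ord.
pose y : R := pi * (i.+1%:R / k%:R).
have -> : i.+1%:R * (2 * pi / k%:R) = y *+ 2 by rewrite /y -mulr_natl; ring.
rewrite cos_mulr2n cos2sin2.
have : 0 < sin y.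
  apply: sin_gt0_pi; rewrite mulr_gt0 ?pi_gt0 ?divr_gt0 ?ltr0n //=.
  by rewrite gtr_pMr ?pi_gt0 // ltr_pdivrMr // mul1r ltr_nat.
move: (sin y) => s s0; rewrite lt_eqF // -mulr_natl.
by have := exprn_gt0 2 s0; lra.
Qed.

Lemma sum_root_of_unity (F : fieldType) (k : nat) (w : F) : w ^+ k = 1 ->
  \sum_(s < k) w ^+ s = if w == 1 then k%:R else 0.
Proof.
move=> wk; case: eqP => [->|/eqP w1].
  by under eq_bigr do rewrite expr1n; rewrite sumr_const card_ord.
have := subrX1 w k; rewrite wk subrr => /esym/eqP; rewrite mulf_eq0 subr_eq0.
by rewrite (negbTE w1) => /eqP.
Qed.

(** Expanding the exponentials and exchanging sums, the coefficient of [1 / n!]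
    becomes a sum of [k]-th roots of unity raised to the powers [n] and [n - 1],
    which keeps the [n] congruent to 0 or 1 modulo [k].  The term [s = 0]
    contributes nothing, so the sum may start there. *)
Lemma sum_cexp_omega (R : realType) (k : nat) : (1 < k)%N ->
  \sum_(1 <= s < k) cexp (omega R k ^+ s) * (1 - omega R k ^- s) =
  ((k%:R * limn (series (renewal_coef R k)))%:C)%C.
Proof.
move=> k1; have k0 : (0 < k)%N by exact: ltnW.
pose w : complex_field R := omega R k.
have wp : k.-primitive_root w := omega_primitive R k0.
pose S M : complex_field R :=
  \sum_(1 <= s < k) series (fun n => (w ^+ s) ^+ n / n`!%:R) M * (1 - w ^- s).
have cS : S @ \oo --> \sum_(1 <= s < k) cexp (w ^+ s) * (1 - w ^- s).
  apply: cvg_big => [|s _]; first exact: add_continuous.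
  by apply: cvgM; [exact: is_cvg_cexp|exact: cvg_cst].
have wV : w^-1 = w ^+ k.-1.
  have w0 : w != 0.
    apply/eqP => w0; have := prim_expr_order wp.
    by rewrite w0 expr0n gtn_eqF // => /esym/eqP; rewrite oner_eq0.
  by apply: (mulfI w0); rewrite mulfV // -exprS prednK // prim_expr_order.
have w_sum m : \sum_(s < k) (w ^+ m) ^+ s = k%:R * (m == 0 %[mod k])%:R.
  rewrite sum_root_of_unity; last by rewrite exprAC (prim_expr_order wp) expr1n.
  rewrite -(prim_order_dvd wp) /dvdn mod0n.
  by case: eqP; rewrite ?mulr1 ?mulr0.
have SE M : S M = ((k%:R * series (renewal_coef R k) M)%:C)%C.
  rewrite rmorphM rmorph_nat seriesEnat /= rmorph_sum mulr_sumr /S.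
  rewrite (eq_bigr (fun s => \sum_(0 <= n < M) n`!%:R^-1 *
     ((w ^+ n) ^+ s - (w ^+ (n + k.-1)) ^+ s))); last first.
    move=> s _; rewrite seriesEnat /= mulr_suml; apply: eq_bigr => n _.
    rewrite -exprVn wV [_ / _]mulrC -mulrA; congr (_ * _).
    by rewrite mulrBr mulr1 exprAC exprD exprMn.
  (* n + k.-1 stands for n - 1, as w ^ -1 = w ^ k.-1 *)
  rewrite exchange_big; apply: eq_bigr => n _ /=.
  rewrite -mulr_sumr.
  transitivity (n`!%:R^-1 *
      \sum_(s < k) ((w ^+ n) ^+ s - (w ^+ (n + k.-1)) ^+ s)).
    by rewrite -(big_mkord predT (fun s => (w ^+ n) ^+ s - (w ^+ (n + k.-1)) ^+ s))
      [in RHS](big_ltn k0) !expr0 subrr add0r.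
  rewrite sumrB !w_sum.
  have -> : (n + k.-1 == 0 %[mod k]) = (n == 1 %[mod k]).
    by rewrite -(eqn_modDr 1) -addnA addn1 prednK // modnDr.
  by rewrite rmorphM fmorphV rmorph_nat rmorphB !rmorph_nat; ring.
rewrite -(cvg_lim (@norm_hausdorff _ _) cS).
apply/(cvg_lim (@norm_hausdorff _ _)).
have -> : S = fun M => ((k%:R * series (renewal_coef R k) M)%:C)%C by apply/funext.
apply: cvg_complex => /=; last exact: cvg_cst.
by apply: cvgM; [exact: cvg_cst|exact: is_cvg_renewal].
Qed.

(** * The formula *)

Theorem theorem6p1 (R : realType) (d : measure_display)
    (Omega : measurableType d) (P : probability Omega R)
    (X : nat -> {RV P >-> R}) (k : nat) :
  (2 <= k)%N ->
  mutually_independent X ->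
  (forall n, same_distribution (X n) (X 0%N)) ->
  distribution P (X 0%N) `<< @lebesgue_measure R ->
  exists mu : R,
    expected_streak_time X k = mu%:E /\
    (mu%:C)%C = k%:R / \sum_(1 <= s < k)
      cexp (omega R k ^+ s) * (1 - omega R k ^- s).
Proof.
move=> k1 indep ident /dominated_diffuse diffuse.
exists (limn (series (renewal_coef R k)))^-1; split.
  exact: expected_streak_time_renewal.
rewrite sum_cexp_omega // rmorphM rmorph_nat fmorphV invfM mulrA divff ?mul1r //.
by rewrite pnatr_eq0 -lt0n ltnW.
Qed.
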